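(* Let $P$ be a poset all of whose principal order ideals are finite and let $\phi:\phi(0)<\phi(1)<\cdots<\phi(n-1)$ be a finite nonempty chain in $P$. Then the lattice $\mathrm{Tam}(P,\phi)$ is left modular. Moreover, let $\mathcal{L}: e_1\prec e_2\prec\cdots\prec e_m$ (with $m=|\mathcal{C}_P^{\phi}|$) be a linear extension of the dual of $(\mathcal{C}_P^{\phi},\leq_{prod})$ such that (a) $(y,j)\prec(x,i)$ whenever $j>i$, for $(x,i)\in\mathcal{C}_i$ and $(y,j)\in\mathcal{C}_j$; (b) for all $0\le i\le k<n$ and $(x,k)\in\mathcal{C}_k$, if $(x,k)\not\leq(\phi(i),k)$ then $(x,k)\prec(\phi(i),k)$. Then the edge-labelling $\omega_{\mathcal{L}}$ of $\mathrm{Tam}(P,\phi)$ is an EL-labelling.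
   Context: For $x\in P$, $I_P(x)=\{y\in P\mid y\le x\}$. For $0\le i<n$ let $\mathcal{C}_i=I_P(\phi(i))\times\{i\}$, ordered by $(x,i)\le (y,i)$ iff $x\le y$ in $P$, and let $\mathcal{C}_P^{\phi}=\bigsqcup_{0\le i<n}\mathcal{C}_i$ be the disjoint union of these posets (elements of different components are incomparable). An order filter (up-closed subset) $T$ of $\mathcal{C}_P^{\phi}$ is torclosed if for all $0\le i<j<n$ and all $x$, $(x,i)\in T$ and $(\phi(i+1),j)\in T$ imply $(x,j)\in T$. $\mathrm{Tam}(P,\phi)$ is the set of torclosed subsets of $\mathcal{C}_P^{\phi}$ ordered by inclusion; it is a finite lattice whose meet is intersection. The product order $\leq_{prod}$ on the set $\mathcal{C}_P^{\phi}$ is: $(x,i)\leq_{prod}(y,j)$ iff $x\le y$ in $P$ and $i\le j$. A linear extension of a poset $(Q,\le)$ is a total order $\preceq$ on $Q$ such that $x\le y$ implies $x\preceq y$ (so in a linear extension of the dual, larger elements for $\leq_{prod}$ come first). For a cover relation $T\lessdot T'$ of $\mathrm{Tam}(P,\phi)$, the set $T'\setminus T$ is contained in a single component $\mathcal{C}_k$ and has a maximum element (for the order of $\mathcal{C}_k$); if this maximum is $e_r$, then $\omega_{\mathcal{L}}(T\lessdot T'):=r\in\{1,\dots,m\}$. An element $a$ of a lattice $L$ is left modular if for all $b<c$ in $L$, $(b\vee a)\wedge c=b\vee(a\wedge c)$; $L$ is left modular if it has a maximal chain all of whose elements are left modular. An edge-labelling of a finite lattice (a map from cover relations to a poset, here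 to the integers) is an EL-labelling if in every interval, reading labels along maximal chains from bottom to top, there is a unique increasing maximal chain, and its label word lexicographically precedes the label word of every other maximal chain of the interval. *)

(* Defs.v *)
From HB Require Import structures.
From mathcomp Require finmap.
From mathcomp Require Import boolp classical_sets cardinality.
From mathcomp Require Import all_boot all_order.

Set Implicit Arguments.
Unset Strict Implicit.
Unset Printing Implicit Defensive.

Import Order.TTheory.
Local Open Scope order_scope.

Section FiniteLattices.
Variables (d : Order.disp_t).

Definition covers (L : finPOrderType d) : rel L :=
  [rel x y | (x < y) && [forall z, ~~ (x < z < y)]].

(* The maximal chains [x = x_0 <. x_1 <. ... <. x_k = y] of the interval
   [x, y] are encoded by the sequences [s = [:: x_1; ...; x_k]]. *)
Definition maxchain (L : finPOrderType d) (x y : L) (s : seq L) : bool :=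
  path (@covers L) x s && (last x s == y).

Definition label_word (L : finPOrderType d) (d' : Order.disp_t)
    (W : porderType d') (lam : L -> L -> W) (x : L) (s : seq L) : seqlexi W :=
  pairmap lam x s.

(* A labelling of the cover relations is a function on all pairs, of which only
   the values on cover relations are used. *)
Definition EL_labelling (L : finPOrderType d) (d' : Order.disp_t)
    (W : porderType d') (lam : L -> L -> W) : Prop :=
  forall x y : L, x <= y ->
  exists s : seq L,
    [/\ maxchain x y s,
        sorted <%O (label_word lam x s),
        forall t, maxchain x y t -> sorted <%O (label_word lam x t) -> t = s
      & forall t, maxchain x y t -> t <> s ->
          label_word lam x s < label_word lam x t].

Definition chain_set (L : finPOrderType d) (A : {set L}) : bool :=
  [forall x in A, forall y in A, x >=< y].

Definition left_modular_elt (L : latticeType d) (a : L) : Prop :=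
  forall b c : L, b < c -> (b `|` a) `&` c = b `|` (a `&` c).

Definition left_modular (L : finLatticeType d) : Prop :=
  exists A : {set L},
    maxset (@chain_set L) A /\ {in A, forall a, left_modular_elt a}.

End FiniteLattices.

Definition linear_extension (Q : Type) (le prec : rel Q) : Prop :=
  [/\ total prec, antisymmetric prec, transitive prec
    & forall x y, le x y -> prec x y].

Definition finite_ideals (d : Order.disp_t) (P : porderType d) : Prop :=
  forall x : P, finite_set [set y : P | y <= x]%classic.

(* The proof [finP] is a parameter of the type so that its finiteness can be
   declared as a canonical instance. *)
Record cell (d : Order.disp_t) (P : porderType d) (finP : finite_ideals P)
    (n : nat) (phi : 'I_n -> P) : Type :=
  Cell { cell_pair : P * 'I_n; _ : cell_pair.1 <= phi cell_pair.2 }.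

Section Cell.
Variables (d : Order.disp_t) (P : porderType d) (finP : finite_ideals P).
Variables (n : nat) (phi : 'I_n -> P).
Local Notation C := (cell finP phi).

HB.instance Definition _ := [isSub of C for @cell_pair d P finP n phi].
HB.instance Definition _ := [Choice of C by <:].

Definition cell_seq : seq (P * 'I_n) :=
  [seq (x, i) | i <- enum 'I_n, x <- finmap.enum_fset
                   (fset_set [set y : P | y <= phi i]%classic)].

Fact mem_cell_seq (c : C) : cell_pair c \in cell_seq.
Proof.
apply/allpairsPdep; case: c => -[x i] /= le_x; exists i, x; split=> //.
  exact: mem_enum.
by rewrite in_fset_set ?classical_sets.inE.
Qed.

Definition cell_to_seq (c : C) : seq_sub cell_seq := SeqSub (mem_cell_seq c).
Definition cell_of_seq (u : seq_sub cell_seq) : option C := insub (ssval u).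
Fact cell_to_seqK : pcancel cell_to_seq cell_of_seq.
Proof. by move=> c; rewrite /cell_of_seq /= valK. Qed.

HB.instance Definition _ :=
  Choice_isCountable.Build C (pcan_pickleK cell_to_seqK).
HB.instance Definition _ := isFinite.Build C (pcan_enumP cell_to_seqK).

Definition elt (c : C) : P := (cell_pair c).1.
Definition idx (c : C) : 'I_n := (cell_pair c).2.

Definition cell_le : rel C := [rel a b | (idx a == idx b) && (elt a <= elt b)].

Fact cell_le_refl : reflexive cell_le.
Proof. by move=> a; rewrite /cell_le /= eqxx lexx. Qed.

Fact cell_le_anti : antisymmetric cell_le.
Proof.
move=> a b; rewrite /cell_le /= => /andP[/andP[/eqP eab le_ab] /andP[_ le_ba]].
apply/val_inj => /=; move: eab le_ab le_ba; rewrite /idx /elt.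
case: (cell_pair a) (cell_pair b) => [x i] [y j] /= -> xy yx.
by congr pair; apply/le_anti/andP.
Qed.

Fact cell_le_trans : transitive cell_le.
Proof.
move=> b a c; rewrite /cell_le /= => /andP[/eqP-> ab] /andP[/eqP-> bc].
by rewrite eqxx (le_trans ab bc).
Qed.

HB.instance Definition _ :=
  Order.Le_isPOrder.Build d C cell_le_refl cell_le_anti cell_le_trans.

Definition cell_prod_le : rel C :=
  [rel a b | (elt a <= elt b) && (idx a <= idx b)%N].

Definition up_closed (T : {set C}) : Prop :=
  forall a b : C, a \in T -> a <= b -> b \in T.

(* Here [a = (x, i)], [b = (phi (i + 1), j)] and [c = (x, j)]; the last two
   pairs are elements of [C] for all [(x, i)] in [C] and [i < j] as soon as
   [phi] is increasing. *)
Definition torclosed (T : {set C}) : Prop :=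
  up_closed T /\
  forall (i i1 j : 'I_n) (x : P), (i < j)%N -> i1 = i.+1 :> nat ->
  forall a b c : C,
  cell_pair a = (x, i) -> cell_pair b = (phi i1, j) -> cell_pair c = (x, j) ->
  a \in T -> b \in T -> c \in T.

Record tam : Type := Tam { tam_set : {set C}; _ : `[< torclosed tam_set >] }.

HB.instance Definition _ := [isSub for tam_set].
HB.instance Definition _ := [Finite of tam by <:].

End Cell.

Fact tam_display : Order.disp_t. Proof. exact: Order.Disp tt tt. Qed.

Section Tam.
Variables (d : Order.disp_t) (P : porderType d) (finP : finite_ideals P).
Variables (n : nat) (phi : 'I_n -> P).
Local Notation C := (cell finP phi).
Local Notation L := (tam finP phi).

Definition tam_le : rel L := [rel T U : L | tam_set T \subset tam_set U].

Fact tam_le_refl : reflexive tam_le.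
Proof. by move=> T; rewrite /tam_le /=. Qed.

Fact tam_le_anti : antisymmetric tam_le.
Proof. by move=> T U TU; apply/val_inj/eqP; rewrite eqEsubset. Qed.

Fact tam_le_trans : transitive tam_le.
Proof. by move=> U T V; apply: subset_trans. Qed.

HB.instance Definition _ :=
  Order.Le_isPOrder.Build tam_display L tam_le_refl tam_le_anti tam_le_trans.

Fact torclosed_bigcap (F : pred L) :
  `[< torclosed (\bigcap_(T in F) tam_set T) >].
Proof.
apply/asboolP; split=> [a b /bigcapP aF ab | i i1 j x ij i1E a b c aE bE cE].
  apply/bigcapP => T FT; have /asboolP[up _] := valP T.
  exact: up (aF T FT) ab.
move=> /bigcapP aF /bigcapP bF; apply/bigcapP => T FT.
have /asboolP[_ tc] := valP T.
exact: tc ij i1E _ _ _ aE bE cE (aF T FT) (bF T FT).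
Qed.

Fact torclosedI (T U : L) : `[< torclosed (tam_set T :&: tam_set U) >].
Proof.
have /asboolP[upT tcT] := valP T; have /asboolP[upU tcU] := valP U.
apply/asboolP; split=> [a b /setIP[aT aU] ab | i i1 j x ij i1E a b c aE bE cE].
  by rewrite inE (upT a) // (upU a).
move=> /setIP[aT aU] /setIP[bT bU].
by rewrite inE (tcT i i1 j x ij i1E a b c) // (tcU i i1 j x ij i1E a b c).
Qed.

Definition tam_meet (T U : L) : L :=
  Sub (tam_set T :&: tam_set U) (torclosedI T U).

Definition tam_join (T U : L) : L :=
  Sub (\bigcap_(V in [pred V : L | (T <= V) && (U <= V)]) tam_set V)
      (torclosed_bigcap _).

Fact tam_meetP (T U V : L) : (T <= tam_meet U V) = (T <= U) && (T <= V).
Proof. by rewrite -[LHS]/(_ \subset tam_set U :&: tam_set V) subsetI. Qed.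

Fact tam_joinP (T U V : L) : (tam_join T U <= V) = (T <= V) && (U <= V).
Proof.
apply/idP/idP => [|TUV]; last exact: (bigcap_inf V).
have ub : forall W : L, (W == T) || (W == U) -> W <= tam_join T U.
  move=> W WTU; apply/bigcapsP => X /andP[TX UX].
  by case/orP: WTU => /eqP->.
move=> le_V; apply/andP; split; apply: le_trans le_V; apply: ub;
  by rewrite eqxx ?orbT.
Qed.

HB.instance Definition _ :=
  Order.POrder_MeetJoin_isLattice.Build tam_display L tam_meetP tam_joinP.

Section Labelling.
Variable prec : rel C.

(* The [r] such that [c = e_r], where [e_1, ..., e_m] lists [C] in increasing
   order for [prec]. *)
Definition position (c : C) : nat := (index c (sort prec (enum {: C}))).+1.

(* [T'] minus [T] has a maximum whenever [T'] covers [T]; the value [0] is only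
   taken on pairs which are not cover relations. *)
Definition omega (T T' : L) : nat :=
  let D := tam_set T' :\: tam_set T in
  if [pick c in D | [forall b in D, b <= c]] is Some c then position c else 0%N.

End Labelling.
End Tam.

(* Main.v *)
(** For an order on the cells satisfying (a) and (b), every initial segment A is
torclosed, and the join of any T with A is obtained from the union of T and A by
adding in one step the cells above some (x, j) with (x, i) in T, i < j and
(phi (i + 1), j) in A. Condition (b) then shows that A is left modular: a cell of
U added in this step is either in A, or below (phi (i + 1), j), which then lies in
both A and U. The initial segments form a maximal chain, because an element
comparable with all of them is itself initial; and orders satisfying (a) and (b)
exist. For the labelling, the least cell c of U \ T has the smallest label
available between T and U; by left modularity there is exactly one cover of T
below U containing c, namely the join of T with the meet of U and the segment of
c, and all labels above it are larger. The increasing chain always takes this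
cover. *)

Require Import Defs.
From mathcomp Require Import boolp.
From mathcomp Require Import all_boot all_order.
Import Order.TTheory.
Local Open Scope order_scope.

Set Implicit Arguments.
Unset Strict Implicit.
Unset Printing Implicit Defensive.

Section Tam.
Variables (d : Order.disp_t) (P : porderType d) (finP : finite_ideals P).
Variables (n : nat) (phi : 'I_n -> P).
Hypothesis phi_lt : forall i j : 'I_n, (i < j)%N -> phi i < phi j.
Local Notation C := (cell finP phi).
Local Notation L := (tam finP phi).

(** * Cells and the torclosed rule *)

Lemma phi_le (i j : 'I_n) : (i <= j)%N -> phi i <= phi j.
Proof. by rewrite leq_eqVlt => /predU1P[/val_inj->|/phi_lt/ltW]. Qed.

Lemma cell_leE (a b : C) : (a <= b) = (idx a == idx b) && (elt a <= elt b).
Proof. by []. Qed.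

Lemma elt_le (a : C) : elt a <= phi (idx a).
Proof. exact: valP a. Qed.

Lemma cell_pairE (a : C) : cell_pair a = (elt a, idx a).
Proof. by rewrite /elt /idx; case: (cell_pair a). Qed.

Lemma cell_exists (x : P) (j : 'I_n) :
  x <= phi j -> exists c : C, cell_pair c = (x, j).
Proof. by move=> xj; exists (@Cell _ _ finP _ phi (x, j) xj). Qed.

Lemma tam_up (T : L) : up_closed (tam_set T).
Proof. by case/asboolP: (valP T). Qed.

Lemma tam_tor (T : L) (a b c : C) (i1 : 'I_n) :
  a \in tam_set T -> b \in tam_set T -> (idx a < idx c)%N ->
  i1 = (idx a).+1 :> nat -> elt a = elt c -> cell_pair b = (phi i1, idx c) ->
  c \in tam_set T.
Proof.
move=> aT bT ac i1E eac bE; have /asboolP[_ tc] := valP T.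
apply: (tc _ _ _ (elt a) ac i1E a b c) => //; first exact: cell_pairE.
by rewrite cell_pairE eac.
Qed.

(** Since [elt a <= elt c <= phi (idx c)], the pair [(elt a, idx c)] is a cell; the torclosed rule
    puts it in [T], and [c] lies above it. *)
Lemma tam_tor_le (T : L) (a b c : C) (i1 : 'I_n) :
  a \in tam_set T -> b \in tam_set T -> (idx a < idx c)%N ->
  i1 = (idx a).+1 :> nat -> elt a <= elt c -> cell_pair b = (phi i1, idx c) ->
  c \in tam_set T.
Proof.
move=> aT bT ac i1E eac bE.
have [c' c'E] := cell_exists (le_trans eac (elt_le c)).
have [ec' ic'] : elt c' = elt a /\ idx c' = idx c by rewrite /elt /idx c'E.
apply: (@tam_up T c'); last by rewrite cell_leE ec' ic' eqxx.
by apply: (tam_tor aT bT _ i1E); rewrite ?ec' ?ic'.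
Qed.

(** * Initial segments: torclosedness, joins, left modularity, maximality *)

Section Order.
Variable prec : rel C.
Hypothesis prec_lin : linear_extension (fun a b => cell_prod_le b a) prec.
Hypothesis prec_idx :
  forall a b : C, (idx a < idx b)%N -> (b != a) && prec b a.
Hypothesis prec_phi : forall (i k : 'I_n) (a b : C), (i <= k)%N ->
  idx a = k -> cell_pair b = (phi i, k) -> ~~ (a <= b) -> (a != b) && prec a b.

Let prec_total : total prec. Proof. by case: prec_lin. Qed.
Let prec_anti : antisymmetric prec. Proof. by case: prec_lin. Qed.
Let prec_trans : transitive prec. Proof. by case: prec_lin. Qed.
Let prec_refl : reflexive prec.
Proof. by move=> a; have := prec_total a a; rewrite orbb. Qed.

Lemma prec_ge (a b : C) : a <= b -> prec b a.
Proof.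
case: prec_lin => _ _ _ ext; rewrite cell_leE => /andP[/eqP ab eab].
by apply: ext; rewrite /cell_prod_le /= eab ab leqnn.
Qed.

Lemma prec_idx_gt (a b : C) : (idx a < idx b)%N -> prec b a.
Proof. by case/prec_idx/andP. Qed.

Definition initial (A : {set C}) : bool :=
  [forall b in A, forall a, prec a b ==> (a \in A)].

Lemma initialP (A : {set C}) :
  reflect (forall a b, b \in A -> prec a b -> a \in A) (initial A).
Proof.
apply: (iffP forall_inP) => [iA a b bA ab | iA b bA].
  by have /forallP/(_ a)/implyP := iA b bA; apply.
by apply/forallP => a; apply/implyP; apply: iA bA.
Qed.

(** Each rule yields a cell that [prec] places before one of its premises: a larger cell of the same
    component, or by (a) a cell of a later component. *)
Lemma initial_torclosed (A : {set C}) : initial A -> `[< torclosed A >].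
Proof.
move=> /initialP iA; apply/asboolP; split=> [a b aA ab | ].
  exact: iA aA (prec_ge ab).
move=> i i1 j x ij _ a b c aE _ cE aA _; apply: iA aA _.
by apply: prec_idx_gt; rewrite /idx aE cE.
Qed.

Definition segment (c : C) : {set C} := [set a | prec a c].

Lemma segment_initial (c : C) : initial (segment c).
Proof.
by apply/initialP => a b; rewrite !inE => bc ab; apply: prec_trans bc.
Qed.

Definition tam_segment (c : C) : L :=
  Tam (initial_torclosed (segment_initial c)).

(** Asking for [elt a <= elt c] instead of equality builds upward closure into the one-step rule. *)
Definition linked (T A : {set C}) (c : C) : Prop :=
  exists (a b : C) (i1 : 'I_n),
    [/\ a \in T, b \in A & elt a <= elt c] /\
    [/\ (idx a < idx c)%N, i1 = (idx a).+1 :> nat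
      & cell_pair b = (phi i1, idx c)].

Lemma join_initial_torclosed (T A : L) : initial (tam_set A) ->
  `[< torclosed (tam_set T :|: tam_set A :|:
                 [set c | `[< linked (tam_set T) (tam_set A) c >]]) >].
Proof.
move=> /initialP iA; apply/asboolP; split=> [a b | ].
  rewrite !inE.
  move=> /orP[/orP[aT|aA]|/asboolP[a1 [b1 [i1 [[? ? le1] [lt1 ? E]]]]]] ab.
  - by rewrite (tam_up aT ab).
  - by rewrite (tam_up aA ab) orbT.
  - apply/orP; right; apply/asboolP; exists a1, b1, i1.
    move: ab; rewrite cell_leE => /andP[/eqP iab eab].
    by rewrite -iab; split; split=> //; apply: le_trans eab.
move=> i i1 j x ij i1E a b c aE bE cE.
have [[ea ia] [ec ic]] :
    (elt a = x /\ idx a = i) /\ (elt c = x /\ idx c = j).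
  by rewrite /elt /idx aE cE.
(* By (a), one cell of [A] in component [i] forces [c] into [A]. This settles every case where [a]
   is not in [T], since the witness [b1] of a linked [a] lies in component [i]. *)
have Ac u : u \in tam_set A -> idx u = i -> c \in tam_set A.
  by move=> uA iu; apply: iA uA _; apply: prec_idx_gt; rewrite iu ic ij.
rewrite !inE.
move=> /orP[/orP[aT|aA]|/asboolP[a1 [b1 [i2 [[_ b1A _] [_ _ E]]]]]];
  last 2 first.
- by move=> _; rewrite (Ac a) ?orbT.
- by move=> _; rewrite (Ac b1) ?orbT // /idx E ia.
have linkA b0 : b0 \in tam_set A -> cell_pair b0 = (phi i1, j) ->
    linked (tam_set T) (tam_set A) c.
  by move=> b0A b0E; exists a, b0, i1; rewrite ia ea ic ec.
move=> /orP[/orP[bT|bA]|/asboolP[a2 [b2 [i2 [[a2T b2A le2] [lt2 i2E b2E]]]]]].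
- by rewrite (@tam_tor T a b c i1) ?ia ?ic ?ea ?ec.
- by apply/orP; right; apply/asboolP; apply: linkA bA bE.
have [eb ib] : elt b = phi i1 /\ idx b = j by rewrite /elt /idx bE.
apply/orP; right; apply/asboolP; rewrite eb in le2; rewrite ib in lt2 b2E.
have [i_a2|a2_i|ia2] := ltngtP i (idx a2).
(* The cell [a3 = (phi i1, idx a2)] is above [a2], hence in [T]; with [a] it gives
   [a4 = (x, idx a2)] in [T], and [a4] and [b2] link [c]. *)
- have i1a2 : phi i1 <= phi (idx a2) by apply: phi_le; rewrite i1E.
  have [a3 a3E] := cell_exists i1a2.
  have a3T : a3 \in tam_set T.
    by apply: tam_up a2T _; rewrite cell_leE /elt /idx a3E eqxx.
  have xi : x <= phi i by have := elt_le a; rewrite ea ia.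
  have [a4 a4E] := cell_exists (le_trans xi (phi_le (ltnW i_a2))).
  have [ea4 ia4] : elt a4 = x /\ idx a4 = idx a2 by rewrite /elt /idx a4E.
  exists a4, b2, i2; rewrite ea4 ia4 ec ic; split; split => //.
  by apply: (@tam_tor T a a3 a4 i1); rewrite ?ia ?ea ?ia4 ?ea4.
(* Here [i2 < i1], so [b2 <= b] and [b] already lies in [A]. *)
- apply: (linkA b) => //; apply: tam_up b2A _.
  rewrite cell_leE /elt /idx b2E bE eqxx /=; apply: phi_le.
  by rewrite i2E i1E ltnS ltnW.
- apply: (linkA b2) => //; rewrite b2E; congr (phi _, _).
  by apply: val_inj; rewrite /= i2E i1E ia2.
Qed.

Lemma mem_join_initial (T A : L) (c : C) : initial (tam_set A) ->
  c \in tam_set (T `|` A) ->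
  [\/ c \in tam_set T, c \in tam_set A | linked (tam_set T) (tam_set A) c].
Proof.
move=> iA cTA.
pose M : L := Tam (join_initial_torclosed T iA).
have: T `|` A <= M.
  rewrite leUx; apply/andP; split; apply/subsetP => e eT;
    by rewrite /= !inE eT ?orbT.
move/subsetP/(_ c cTA); rewrite /= !inE.
by case/orP=> [/orP[]|/asboolP]; [constructor 1 | constructor 2 | constructor 3].
Qed.

Lemma initial_left_modular (A : L) :
  initial (tam_set A) -> left_modular_elt A.
Proof.
move=> iA T U /ltW TU; apply/le_anti/andP; split; last first.
  by rewrite lexI !leUx TU leUl leIr /= andbT (le_trans (leIl A U)) ?leUr.
set V := T `|` (A `&` U).
have TV : {subset tam_set T <= tam_set V} by apply/subsetP; apply: (leUl T (A `&` U)).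
have AUV c : c \in tam_set A -> c \in tam_set U -> c \in tam_set V.
  by move=> cA cU; apply: (subsetP (leUr (A `&` U) T)); apply/setIP.
apply/subsetP => c /setIP[+ cU].
case/(mem_join_initial iA) => [/TV//|cA|]; first exact: AUV.
move=> [a [b [i1 [[aT bA eac] [ac i1E bE]]]]].
have [cb|cNb] := boolP (c <= b).
  exact: tam_tor_le (TV _ aT) (AUV _ bA (tam_up cU cb)) ac i1E eac bE.
apply: AUV => //; move/initialP: iA => /(_ c b bA); apply.
have i1c : (i1 <= idx c)%N by rewrite i1E.
by case/andP: (prec_phi i1c erefl bE cNb).
Qed.

(** For maximality, let [b] be in [T] and [a] precede [b]. Comparing [T] with the segment of [a]
    gives either [b] before [a], so [a = b], or the whole segment, with [a], inside [T]. *)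
Lemma initial_chain :
  maxset (@chain_set tam_display L) [set A | initial (tam_set A)].
Proof.
apply/maxsetP; split=> [|B /forall_inP chB sB].
  apply/forall_inP => A; rewrite inE => /initialP iA.
  apply/forall_inP => B; rewrite inE => /initialP iB.
  rewrite /Order.comparable; have [//|] := boolP (A <= B).
  case/subsetPn=> a aA aB; apply/subsetP => b bB.
  case/orP: (prec_total a b) => ab; last exact: iA aA ab.
  by rewrite (iB _ _ bB ab) in aB.
apply/eqP; rewrite eqEsubset sB andbT; apply/subsetP => T TB.
rewrite inE; apply/initialP => a b bT ab.
have aB : tam_segment a \in B.
  by apply: (subsetP sB); rewrite inE; apply: segment_initial.
have /forall_inP/(_ _ aB)/orP[/subsetP|/subsetP] := chB T TB.
  move/(_ b bT); rewrite inE => ba.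
  by rewrite (@prec_anti a b) ?ab.
by apply; rewrite inE.
Qed.


(** * Labels, first cells and the increasing chain *)

Lemma position_inj : injective (position prec).
Proof.
move=> a b [] E; rewrite -[a](nth_index a (s := sort prec (enum {: C}))).
  by rewrite E nth_index // mem_sort mem_enum.
by rewrite mem_sort mem_enum.
Qed.

Lemma position_le (a b : C) : (position prec a <= position prec b)%N = prec a b.
Proof.
have le_prec x y : (position prec x <= position prec y)%N -> prec x y.
  by apply: (sorted_leq_index prec_trans prec_refl
    (sort_sorted prec_total (enum {: C}))); rewrite mem_sort mem_enum.
apply/idP/idP; first exact: le_prec.
move=> ab; rewrite leqNgt; apply/negP => lt_ba.
have ba := le_prec _ _ (ltnW lt_ba).
by rewrite (@prec_anti a b) ?ab // ltnn in lt_ba.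
Qed.

Definition first (T U : L) (c : C) : Prop :=
  [/\ c \in tam_set U, c \notin tam_set T
    & forall b, b \in tam_set U -> b \notin tam_set T -> prec c b].

Lemma first_exists (T U : L) : T < U -> exists c, first T U c.
Proof.
move=> TU; have /subsetPn[c0 c0U c0T] : ~~ (U <= T) by rewrite lt_geF.
pose D := tam_set U :\: tam_set T.
have c0D : c0 \in D by rewrite inE c0T.
have [c /setDP[cU cT] cmin] :=
  arg_minnP (P := fun x => x \in D) (position prec) c0D.
exists c; split=> // b bU bT; rewrite -position_le; apply: cmin.
by rewrite inE bT.
Qed.

Lemma left_modular_segment (T U : L) (c : C) : T <= U ->
  (T `|` tam_segment c) `&` U = T `|` (tam_segment c `&` U).
Proof.
rewrite le_eqVlt => /predU1P[->|]; first by rewrite joinIKC meetKUC.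
by apply: initial_left_modular; apply: segment_initial.
Qed.

(* When [c] is the first cell of [U] minus [T], this is the bottom step of the
   increasing chain from [T] to [U]. *)
Definition step (T U : L) (c : C) : L := T `|` (tam_segment c `&` U).

(** The only cell of [U] in the segment of [c] that is missing from [T] is [c] itself, so
    [step T U c] is the least element above [T] containing [c]. *)
Lemma step_le (T U V : L) (c : C) : first T U c -> T <= V ->
  c \in tam_set V -> step T U c <= V.
Proof.
move=> [cU cT cmin] TV cV; rewrite leUx TV /=; apply/subsetP => b.
case/setIP; rewrite inE => bc bU.
have [|bT] := boolP (b \in tam_set T); first exact: (subsetP TV).
by rewrite (@prec_anti b c) // bc cmin.
Qed.

Lemma mem_step (T U : L) (c : C) :
  c \in tam_set U -> c \in tam_set (step T U c).
Proof.
move=> cU; apply: (subsetP (leUr (tam_segment c `&` U) T)).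
by rewrite !inE prec_refl.
Qed.

Lemma step_leU (T U : L) (c : C) : T <= U -> step T U c <= U.
Proof. by move=> TU; rewrite leUx TU leIr. Qed.

Lemma step_covers (T U : L) (c : C) : T <= U -> first T U c ->
  covers T (step T U c).
Proof.
move=> TU fc; have [cU cT cmin] := fc; apply/andP; split.
  by rewrite lt_leAnge leUl; apply/subsetPn; exists c => //; apply: mem_step.
apply/forallP => V; apply/negP => /andP[TV VS].
have [cV|cV] := boolP (c \in tam_set V).
  by move: (step_le fc (ltW TV) cV); rewrite lt_geF.
(* Left modularity needs only [T <= V], so [step] is usable although [c] is not in [V]; without [c],
   the meet of its segment with [V] falls inside [T]. *)
have le_step : V <= step T V c.
  rewrite /step -(left_modular_segment c (ltW TV)) lexI lexx andbT.
  by apply: le_trans (ltW VS) _; rewrite /step leU2 // leIl.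
have: V <= T.
  apply: (le_trans le_step).
  rewrite leUx lexx /=; apply/subsetP => b /setIP[]; rewrite inE => bc bV.
  have bU : b \in tam_set U := subsetP (le_trans (ltW VS) (step_leU c TU)) b bV.
  apply: contraNT cV => bT.
  by rewrite -(@prec_anti b c) // bc cmin.
by rewrite lt_geF.
Qed.

(** The cell that is first for [prec] is also the maximum of the difference: the cover equals
    [step T U c], so every new cell is [c] or linked through the segment of [c]. *)
Lemma covers_first (T U : L) (c : C) :
  covers T U -> first T U c -> omega prec T U = position prec c.
Proof.
move=> /andP[TU /forallP noV] fc; have [cU cT cmin] := fc.
have {noV} US : U <= T `|` tam_segment c.
  have /andP[TS _] := step_covers (ltW TU) fc.
  have: step T U c = U.
    have := noV (step T U c); rewrite TS lt_neqAle step_leU ?(ltW TU) //=.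
    by rewrite andbT negbK => /eqP.
  by move=> {1}<-; rewrite leU2 // leIl.
have cmax b : b \in tam_set U -> b \notin tam_set T -> b <= c.
  move=> bU bT; have bc b' :
      prec b' c -> b' \in tam_set U -> b' \notin tam_set T -> b' = c.
    by move=> bc bU' bT'; apply: prec_anti; rewrite bc cmin.
  have := subsetP US b bU.
  case/(@mem_join_initial T (tam_segment c) b (segment_initial c)) => [bT'||].
  - by rewrite bT' in bT.
  - by rewrite inE => /bc ->.
  case=> a [e [i1 [[aT + ab] [lt_ab i1E eE]]]]; rewrite inE => ec.
  (* If [b <= e], then [e] is a new cell of [U], for otherwise the torclosed rule would put [b] in
     [T]; hence [e = c]. If not, (b) places [b] before [e], so [b = c]. *)
  have [be|beN] := boolP (b <= e).
    have eU := tam_up bU be.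
    rewrite -(bc e) //; apply: contra bT => eT.
    exact: tam_tor_le aT eT lt_ab i1E ab eE.
  have i1b : (i1 <= idx b)%N by rewrite i1E.
  have /andP[_ pbe] := prec_phi i1b erefl eE beN.
  by rewrite (bc b) // (prec_trans pbe).
rewrite /omega; case: pickP => [c' /andP[/setDP[c'U c'T] /forall_inP c'max]|].
  congr position; apply/le_anti; rewrite cmax //=; apply: c'max.
  by rewrite inE cT.
move/(_ c); rewrite inE cT cU /= => /forall_inP[] b /setDP[bU bT].
exact: cmax.
Qed.

Lemma maxchain_le (T U : L) (t : seq L) : maxchain T U t -> T <= U.
Proof.
elim: t T => [|V t IHt] T /andP[] /=; first by move=> _ /eqP->.
move=> /andP[/andP[TV _] Vt] tU; apply: le_trans (ltW TV) (IHt V _).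
by rewrite /maxchain Vt.
Qed.

Lemma maxchain_cons (T U V : L) (t : seq L) :
  maxchain T U (V :: t) = covers T V && maxchain V U t.
Proof. by rewrite /maxchain /= andbA. Qed.

Lemma omega_ge (T U V : L) (c : C) : first T U c -> covers T V -> V <= U ->
  (position prec c <= omega prec T V)%N.
Proof.
move=> [_ _ cmin] cov VU; have /andP[/first_exists[a fa] _] := cov.
rewrite (covers_first cov fa) position_le; have [aV aT _] := fa.
by rewrite cmin // (subsetP VU).
Qed.

Lemma omega_EL : EL_labelling (omega prec).
Proof.
move=> T U; have [k] := ubnP #|tam_set U :\: tam_set T|.
elim: k T => // k IHk T ltk; rewrite le_eqVlt => /predU1P[TU|ltTU].
  have nilP t : maxchain T U t -> t = [::].
    case: t => // V t; rewrite maxchain_cons => /andP[/andP[TV _]].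
    by move=> /maxchain_le; rewrite -TU lt_geF.
  exists [::]; split=> //; first by rewrite /maxchain /= TU.
  - by move=> t /nilP.
  - by move=> t /nilP.
have [c fc] := first_exists ltTU; have [cU cT cmin] := fc.
have leTU := ltW ltTU; set V := step T U c.
have covV : covers T V by apply: step_covers.
have VU : V <= U by apply: step_leU.
have cV : c \in tam_set V by apply: mem_step.
have fV : first T V c.
  by split=> // b bV bT; apply: cmin => //; apply: (subsetP VU).
have omegaV : omega prec T V = position prec c by apply: covers_first.
have TV : T < V by case/andP: covV.
have ltV : (#|tam_set U :\: tam_set V| < k)%N.
  rewrite -ltnS; apply: leq_trans ltk; rewrite ltnS; apply: proper_card.
  have sub : tam_set U :\: tam_set V \subset tam_set U :\: tam_set T.
    exact: setDS (ltW TV).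
  rewrite properEneq sub andbT.
  apply: contraNneq cT => /setP/(_ c); rewrite !inE cV cU andbT.
  by case: (c \in tam_set T).
have [s [s_max s_inc s_uniq s_lex]] := IHk V ltV VU.
have coverV W : covers T W -> W <= U -> c \in tam_set W -> W = V.
  move=> /andP[TW /forallP/(_ V)]; rewrite TV /= => VW WU cW; apply/eqP.
  have := step_le fc (ltW TW) cW; rewrite -/V le_eqVlt (negPf VW) orbF.
  by rewrite eq_sym.
have gt_omega W : covers T W -> W <= U -> W <> V ->
    (position prec c < omega prec T W)%N.
  move=> covW WU neWV; have /andP[/first_exists[a fa] _] := covW.
  rewrite ltn_neqAle (omega_ge fc covW WU) andbT (covers_first covW fa).
  apply/eqP => /position_inj ca; apply: neWV; apply: coverV => //.
  by case: fa; rewrite ca.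
exists (V :: s); split.
- by rewrite maxchain_cons covV.
- rewrite /label_word /= omegaV; case: s s_max s_inc {s_uniq s_lex} => //= W s.
  rewrite maxchain_cons => /andP[covW /maxchain_le WU].
  rewrite /label_word /= => ->; rewrite andbT.
  (* The next label is at least the position of the first cell of [U] minus [V], a cell of [U] minus
     [T] other than [c], as [c] is in [V]. *)
  have VltU : V < U by case/andP: covW => VW _; apply: lt_le_trans VW WU.
  have [a fa] := first_exists VltU.
  rewrite ltEnat /=; apply: leq_trans (omega_ge fa covW WU).
  have [aU aV _] := fa; rewrite ltn_neqAle position_le cmin //; last first.
    by apply: contra aV; apply: (subsetP (ltW TV)).
  by rewrite andbT; apply: contraNneq aV => /position_inj <-.
- case=> [|W t]; first by rewrite /maxchain /= lt_eqF.
  rewrite maxchain_cons => /andP[covW Wt] inc.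
  have WU := maxchain_le Wt.
  have [WV|/eqP neWV] := eqVneq W V.
    rewrite WV in Wt inc *; congr cons; apply: s_uniq => //.
    exact: path_sorted inc.
  have lt_c := gt_omega W covW WU neWV.
  have cW : c \notin tam_set W by apply/negP => /(coverV W covW WU).
  have /andP[TW _] := covW.
  (* Some later step adds [c] and hence has the label of [c] at most. *)
  suff [l lt lc] : exists2 l,
      l \in label_word (omega prec) W t & (l <= position prec c)%N.
    have := order_path_min lt_trans inc => /allP/(_ l lt).
    rewrite ltEnat /= => lt_l.
    by have := leq_trans (ltn_trans lt_c lt_l) lc; rewrite ltnn.
  elim: t W cW Wt {inc WU neWV lt_c covW TW} => [|X t IHt] W cW.
    by rewrite /maxchain /= => /eqP WU; rewrite WU cU in cW.
  rewrite maxchain_cons => /andP[covX Xt].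
  have [cX|cX] := boolP (c \in tam_set X); last first.
    have [l lt lc] := IHt X cX Xt; exists l => //.
    by rewrite /label_word /= inE; apply/orP; right.
  exists (omega prec W X); first by rewrite /label_word /= mem_head.
  have /andP[/first_exists[a fa] _] := covX.
  by rewrite (covers_first covX fa) position_le; case: fa => _ _; apply.
- case=> [|W t]; first by rewrite /maxchain /= lt_eqF.
  rewrite maxchain_cons => /andP[covW Wt] neq.
  have WU := maxchain_le Wt; rewrite /label_word /= omegaV.
  have [WV|/eqP neWV] := eqVneq W V.
    rewrite WV omegaV eqhead_ltxiE; apply: s_lex; rewrite -?WV //.
    by move=> ts; apply: neq; rewrite ts WV.
  have lt_c := gt_omega W covW WU neWV.
  by rewrite neqhead_ltxiE ?ltEnat //=; rewrite neq_ltn lt_c.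
Qed.

End Order.

(** * Left modularity, and an explicit order satisfying (a) and (b) *)

Lemma tam_left_modular (prec : rel C) :
  linear_extension (fun a b => cell_prod_le b a) prec ->
  (forall a b : C, (idx a < idx b)%N -> (b != a) && prec b a) ->
  (forall (i k : 'I_n) (a b : C), (i <= k)%N -> idx a = k ->
     cell_pair b = (phi i, k) -> ~~ (a <= b) -> (a != b) && prec a b) ->
  left_modular L.
Proof.
move=> lin pidx pphi; exists [set A : L | initial prec (tam_set A)]; split.
  exact: initial_chain.
by move=> A; rewrite inE; apply: initial_left_modular.
Qed.

(* Sorting each component by decreasing level yields condition (b), since [x] has
   larger level than [phi i] unless [x <= phi i]. *)
Definition level (x : P) : nat := #|[set i | ~~ (x <= phi i)]|.

Lemma level_le (x y : P) : x <= y -> (level x <= level y)%N.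
Proof.
move=> xy; apply/subset_leq_card/subsetP => i; rewrite !inE.
by apply: contra; apply: le_trans.
Qed.

(** The level of [phi i] counts the [j < i]; if [x] is not below [phi i], its level counts all these
    and [i] as well. *)
Lemma level_phi (x : P) (i : 'I_n) :
  ~~ (x <= phi i) -> (level (phi i) < level x)%N.
Proof.
move=> xi; apply: proper_card; apply/properP; split; last first.
  by exists i; rewrite !inE ?lexx.
apply/subsetP => j; rewrite !inE => ij; apply: contra xi => xj.
apply: le_trans xj (phi_le _); rewrite leqNgt; apply: contra ij => ij.
exact: phi_le (ltnW ij).
Qed.

(** The index secures (a), the level (b), the size of the principal ideal compatibility with the
    order inside a component, and the rank breaks the remaining ties. *)
Definition cell_key (a : C) : nat *l (nat *l (nat *l nat)) :=
  (val (idx a), (level (elt a), (#|[set b : C | b <= a]|, val (enum_rank a)))).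

Definition key_prec (a b : C) : bool := cell_key b <= cell_key a.

Lemma cell_key_inj : injective cell_key.
Proof. by move=> a b [_ _ _ /val_inj/enum_rank_inj]. Qed.

Lemma key_prec_linear : linear_extension (fun a b => cell_prod_le b a) key_prec.
Proof.
split=> [a b | a b ab | b a c ab bc | a b].
- exact: le_total.
- by apply: cell_key_inj; apply/le_anti; rewrite andbC.
- exact: le_trans bc ab.
rewrite /cell_prod_le /= => /andP[eba iba].
rewrite /key_prec /cell_key !lexi_pair !leEnat iba; apply/implyP => iab.
rewrite level_le //=; apply/implyP => _.
have ba : b <= a by rewrite cell_leE eba -val_eqE eqn_leq iba iab.
have [->|neab] := eqVneq a b; first by rewrite !leqnn.
have lt_card : (#|[set c : C | (c <= b)%O]| < #|[set c : C | (c <= a)%O]|)%N.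
  apply: proper_card; apply/properP; split.
    by apply/subsetP => c; rewrite !inE => /le_trans; apply.
  exists a; rewrite !inE ?lexx //; apply: contra neab => ab.
  by apply/eqP/le_anti; rewrite ab.
by rewrite (ltnW lt_card) leqNgt lt_card.
Qed.

Lemma key_prec_idx (a b : C) :
  (idx a < idx b)%N -> (b != a) && key_prec b a.
Proof.
move=> ab; rewrite /key_prec /cell_key lexi_pair !leEnat (ltnW ab) leqNgt ab.
by rewrite andbT; apply: contraTneq ab => ->; rewrite ltnn.
Qed.

Lemma key_prec_phi (i k : 'I_n) (a b : C) : (i <= k)%N -> idx a = k ->
  cell_pair b = (phi i, k) -> ~~ (a <= b) -> (a != b) && key_prec a b.
Proof.
move=> ik ak bE Nab.
have [eb ib] : elt b = phi i /\ idx b = k by rewrite /elt /idx bE.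
apply/andP; split; first by apply: contraNneq Nab => ->.
rewrite cell_leE ak ib eb eqxx /= in Nab.
rewrite /key_prec /cell_key ak ib eb !lexi_pair !leEnat leqnn /=.
by rewrite (ltnW (level_phi Nab)) leqNgt (level_phi Nab).
Qed.

End Tam.

Theorem theorem3p24 (d : Order.disp_t) (P : porderType d)
    (finP : finite_ideals P) (n : nat) (phi : 'I_n -> P) (n_gt0 : (0 < n)%N)
    (phi_lt : forall i j : 'I_n, (i < j)%N -> phi i < phi j) :
  left_modular (tam finP phi) /\
  (forall prec : rel (cell finP phi),
     linear_extension (fun a b => cell_prod_le b a) prec ->
     (forall a b : cell finP phi, (idx a < idx b)%N -> (b != a) && prec b a) ->
     (forall (i k : 'I_n) (a b : cell finP phi), (i <= k)%N -> idx a = k ->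
        cell_pair b = (phi i, k) -> ~~ (a <= b) -> (a != b) && prec a b) ->
     EL_labelling (omega prec)).
Proof.
split; last exact: omega_EL.
apply: (tam_left_modular phi_lt (@key_prec_linear _ _ _ _ phi)).
  exact: key_prec_idx.
exact: key_prec_phi phi_lt.
Qed.
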